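(* Let $\theta\in(0,\infty)$ and let $b$ be a smooth function on $\mathbb{R}^3$, homogeneous of degree $\theta^{-1}$ (i.e. $b(\lambda\eta)=\lambda^{1/\theta}b(\eta)$ for $\lambda>0$), with $e^{-b}\in L^1(\mathbb{R}^3)$ and such that $$\varphi:=\mathcal{F}^{-1}(e^{-b(\cdot)})\ge 0,\qquad (\mathcal{F}^{-1}\psi)(p)=(2\pi)^{-3}\int_{\mathbb{R}^3}\psi(\eta)\,e^{ip\cdot\eta}\,d\eta .$$ Let $F=F(t,m)$ be any solution of the Smoluchowski coagulation equation with coagulation kernel $a(m,m')$, $$\partial_t F(t,m)=\frac12\int_0^m F(t,m-m')F(t,m')\,a(m-m',m')\,dm'-\int_0^\infty F(t,m)F(t,m')\,a(m,m')\,dm'.$$ Then the function $$f(t,m,p)=m^{-3\theta}\,F(t,m)\,\varphi\!\left(\frac{p}{m^\theta}\right),\qquad m>0,\ p\in\mathbb{R}^3,$$ is a solution of the ballistic aggregation equation with the same aggregation kernel $a(y,y')=a(m,m')$, that is $$\partial_t f(t,m,p)=\frac12\int_{\mathbb{R}^3}\int_0^m a(m',m-m')f(t,m',p')f(t,m-m',p-p')\,dm'dp'-\int_{\mathbb{R}^3}\int_0^\infty a(m,m')f(t,m,p)f(t,m',p')\,dm'dp'.$$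
   Context: $a(m,m')\ge 0$ is a given symmetric kernel on $(0,\infty)^2$, unrelated to the function $b$. Solutions $F\ge 0$ (resp. $f\ge 0$) are understood as functions for which the integrals in the equation are finite and the equation holds pointwise. *)

(* Defs.v *)
From HB Require Import structures.
From mathcomp Require Import all_boot all_order all_algebra.
From mathcomp Require Import all_classical all_reals all_analysis.
From mathcomp Require Import complex.

Set Implicit Arguments.
Unset Strict Implicit.
Unset Printing Implicit Defensive.

Import Order.TTheory GRing.Theory Num.Theory numFieldNormedType.Exports.

Local Open Scope classical_set_scope.
Local Open Scope ring_scope.

(* Euclidean 3-space as triples ((x, y), z): unlike 'rV[R]_3 this type carries
   both the library's normed-module structure and its product sigma-algebra. *)
Notation R3 R := (R * R * R)%type.

Definition lebesgue3 (R : realType) :=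
  ((@lebesgue_measure R \x @lebesgue_measure R) \x @lebesgue_measure R)%E.
Arguments lebesgue3 : clear implicits.

HB.instance Definition _ (R : realType) := Measure.on (lebesgue3 R).

(* d(p', m') on R^3 x R. A double integral over p' and m' is an integral with
   respect to this measure: for a solution of the ballistic equation the inner
   integral over m' may diverge for p' in a null set. *)
Definition lebesgue3_1 (R : realType) :=
  (lebesgue3 R \x @lebesgue_measure R)%E.
Arguments lebesgue3_1 : clear implicits.

HB.instance Definition _ (R : realType) := Measure.on (lebesgue3_1 R).

Definition dot3 (R : realType) (p eta : R3 R) : R :=
  p.1.1 * eta.1.1 + p.1.2 * eta.1.2 + p.2 * eta.2.

Definition basis3 (R : realType) : seq (R3 R) :=
  [:: (1, 0, 0); (0, 1, 0); (0, 0, 1)].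

(* All partial derivatives of order k exist everywhere and are continuous. *)
Fixpoint continuous_partials (R : realType) (k : nat) (g : R3 R -> R) : Prop :=
  if k is k'.+1 then
    forall v, v \in basis3 R ->
      (forall x, derivable g x v) /\ continuous_partials k' ('D_v g)
  else continuous g.

Definition smooth (R : realType) (g : R3 R -> R) : Prop :=
  forall k, continuous_partials k g.

Definition expi (R : realType) (x : R) : R[i] := (cos x +i* sin x)%C.

(* The library has no integral of complex-valued functions; real and imaginary
   parts are integrated separately. *)
Definition invFourier (R : realType) (psi : R3 R -> R[i]) (p : R3 R) : R[i] :=
  let g eta := psi eta * expi (dot3 p eta) in
  (((2 * pi) ^- 3)%:C *
    ((\int[lebesgue3 R]_eta complex.Re (g eta)) +i*
     (\int[lebesgue3 R]_eta complex.Im (g eta))))%C.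

(* In the two definitions below J is the set of times; only the values at
   t in J and at positive masses matter. Integrability includes measurability
   of the integrand in the integration variables. *)

Definition smoluchowski_solution (R : realType) (a : R -> R -> R) (J : set R)
    (F : R -> R -> R) : Prop :=
  forall t m : R, J t -> 0 < m ->
    let gain m' := F t (m - m') * F t m' * a (m - m') m' in
    let loss m' := F t m * F t m' * a m m' in
    [/\ 0 <= F t m,
        lebesgue_measure.-integrable `]0, m[ (EFin \o gain),
        lebesgue_measure.-integrable `]0, +oo[ (EFin \o loss) &
        is_derive t 1 (fun s => F s m)
          (2^-1 * (\int[lebesgue_measure]_(m' in `]0, m[) gain m')
           - \int[lebesgue_measure]_(m' in `]0, +oo[) loss m')].

Definition ballistic_solution (R : realType) (a : R -> R -> R) (J : set R)
    (f : R -> R -> R3 R -> R) : Prop :=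
  forall (t m : R) (p : R3 R), J t -> 0 < m ->
    let gain (z : R3 R * R) :=
      a z.2 (m - z.2) * f t z.2 z.1 * f t (m - z.2) (p - z.1) in
    let loss (z : R3 R * R) := a m z.2 * f t m p * f t z.2 z.1 in
    [/\ 0 <= f t m p,
        (lebesgue3_1 R).-integrable (setT `*` `]0, m[) (EFin \o gain),
        (lebesgue3_1 R).-integrable (setT `*` `]0, +oo[) (EFin \o loss) &
        is_derive t 1 (fun s => f s m p)
          (2^-1 * (\int[lebesgue3_1 R]_(z in setT `*` `]0, m[) gain z)
           - \int[lebesgue3_1 R]_(z in setT `*` `]0, +oo[) loss z)].

(* Main.v *)
(* Write phi_m(p) = m^(-3 theta) phi(p / m^theta). By homogeneity of b, phi_m is
   the inverse Fourier transform of exp(- m b), so once Fourier inversion is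
   available for these functions, phi_m has integral exp(- m b(0)) = 1 and
   phi_m * phi_m' = phi_(m + m') pointwise. Integrating first in p' (Tonelli), the
   gain and loss terms for f = F phi_m are those for F times phi_m(p).

   Inversion: b >= 0 by integrability and homogeneity, hence exp(- m b) is bounded.
   With W(p) = exp(- |p_1| - |p_2| - |p_3|), Fubini gives that
   int W(e p) phi_m(p) cos(p . eta) dp is the average of exp(- m b(eta + e u)) against
   a product Cauchy kernel in u, which tends to exp(- m b(eta)) as e -> 0. Taking
   eta = 0, monotone convergence (phi_m >= 0) shows that phi_m is integrable, and
   dominated convergence then gives the inversion formula for every eta. *)
Require Import Defs.
From HB Require Import structures.
From mathcomp Require Import all_boot all_order all_algebra.
From mathcomp Require Import all_classical all_reals all_analysis measurable_realfun.
From mathcomp Require Import complex ring lra.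
Import Order.TTheory GRing.Theory Num.Theory numFieldNormedType.Exports.
Local Open Scope classical_set_scope.
Local Open Scope ring_scope.

(** * Substitution and product measures *)

(* The library's product measure of sigma-finite measures has no canonical
   sigma-finite structure: that slot is taken by subprobability measures. *)
Lemma product_measure_sigma_finite {d1 d2 : measure_display}
    {T1 : measurableType d1} {T2 : measurableType d2} {R : realType}
    (m1 : {sigma_finite_measure set T1 -> \bar R})
    (m2 : {sigma_finite_measure set T2 -> \bar R}) :
  sigma_finite setT (m1 \x m2)%E.
Proof.
(* Both exhaustions are nondecreasing, so a point of [F i] times [G j] already lies in the product
   set of index [maxn i j]. *)
have /sigma_finiteP[F [TF ndF Ffin]] := sigma_finiteT m1.
have /sigma_finiteP[G [TG ndG Gfin]] := sigma_finiteT m2.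
exists (fun n => F n `*` G n) => [|n]; last first.
  have [mF oF] := Ffin n; have [mG oG] := Gfin n; split; first exact: measurableX.
  by rewrite product_measure1E// lte_mul_pinfty// ge0_fin_numE.
apply/seteqP; split=> // -[x y] _.
have [i _ Fx] : (\bigcup_i F i) x by rewrite -TF.
have [j _ Gy] : (\bigcup_j G j) y by rewrite -TG.
exists (maxn i j) => //; split.
  by apply: (subsetPset _ _ (ndF _ _ (leq_maxl i j))).
by apply: (subsetPset _ _ (ndG _ _ (leq_maxr i j))).
Qed.

(** The inner factor of [lebesgue3], named so that it can carry the sigma-finite structure required
    of a factor of a product measure. *)
Definition lebesgue2 (R : realType) :=
  (@lebesgue_measure R \x @lebesgue_measure R)%E.
Arguments lebesgue2 : clear implicits.
HB.instance Definition _ (R : realType) := Measure.on (lebesgue2 R).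
HB.instance Definition _ (R : realType) :=
  Measure_isSigmaFinite.Build _ _ _ (lebesgue2 R)
    (product_measure_sigma_finite _ _).
HB.instance Definition _ (R : realType) :=
  Measure_isSigmaFinite.Build _ _ _ (lebesgue3 R)
    (product_measure_sigma_finite (lebesgue2 R) (@lebesgue_measure R)).

Section affine_substitution.
Context {R : realType}.
Notation mu := (@lebesgue_measure R).
Local Open Scope ereal_scope.

Let aff (h c x : R) : measurableTypeR R := (h + c * x)%R.

Let measurable_aff h c : measurable_fun [set: measurableTypeR R] (aff h c).
Proof. by apply: measurable_funD => //; exact: measurable_funM. Qed.

(** The pushforward by [aff h c], scaled by [|c|], agrees with Lebesgue measure on the intervals
    []a, b]], hence everywhere by uniqueness. The sign of [c] decides which end of the preimage
    interval is closed. *)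
Lemma lebesgue_measure_affine (h c : R) (A : set R) : c != 0%R ->
  measurable A ->
  mu A = `|c|%:E * mu ((fun x => h + c * x)%R @^-1` A).
Proof.
move=> c0 mA.
pose P := pushforward mu (aff h c).
pose nu := mscale (NngNum (normr_ge0 c)) P.
change (mu A = nu (measurable_aff h c) A).
apply: lebesgue_measure_unique => //= _ [[a b]] _ <-.
rewrite /nu /mscale/= /P /pushforward.
have [c_gt0|c_lt0|c0'] := ltrgtP 0%R c; last by rewrite -c0' eqxx in c0.
- have -> : aff h c @^-1` `]a, b] = `]((a - h) / c)%R, ((b - h) / c)%R]%classic.
    apply/seteqP; split=> x; rewrite /aff /= !in_itv/= ltr_pdivrMr// ler_pdivlMr//;
    lra.
  rewrite !lebesgue_measure_itv/= !lte_fin ltr_pM2r ?invr_gt0// ltrD2r.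
  rewrite gtr0_norm//; case: ifPn => _; last by rewrite mule0.
  by rewrite -!EFinB -EFinM -mulrBl mulrCA divff// mulr1; congr EFin; lra.
- have -> : aff h c @^-1` `]a, b] = `[((b - h) / c)%R, ((a - h) / c)%R[%classic.
    apply/seteqP; split=> x; rewrite /aff /= !in_itv/= ltr_ndivlMr// ler_ndivrMr//;
    lra.
  rewrite !lebesgue_measure_itv/= !lte_fin ltr_nM2r ?invr_lt0// ltrD2r.
  rewrite ltr0_norm//; case: ifPn => _; last by rewrite mule0.
  by rewrite -!EFinB -EFinM -mulrBl mulNr mulrCA divff// mulr1; congr EFin; lra.
Qed.

Lemma ge0_integral_affine (h c : R) (f : R -> \bar R) : c != 0%R ->
  measurable_fun setT f -> (forall x, 0 <= f x) ->
  \int[mu]_x f x = `|c|%:E * \int[mu]_x f (h + c * x)%R.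
Proof.
move=> c0 mf f0.
pose P := pushforward mu (aff h c).
pose nu := mscale (NngNum (normr_ge0 c)) P.
rewrite (@eq_measure_integral _ _ _ _ (nu (measurable_aff h c))); last first.
  by move=> A mA _; exact: lebesgue_measure_affine.
rewrite ge0_integral_mscale//; congr (_ * _).
by rewrite (ge0_integral_pushforward (measurable_aff h c)).
Qed.

End affine_substitution.

Section product_substitution.
Local Open Scope ereal_scope.
Context {d1 d2 : measure_display} {T1 : measurableType d1}
  {T2 : measurableType d2} {R : realType}.
Variables (m1 : {sigma_finite_measure set T1 -> \bar R})
  (m2 : {sigma_finite_measure set T2 -> \bar R}).
Variables (phi1 : T1 -> T1) (phi2 : T2 -> T2) (k1 k2 : R).
Hypotheses (mphi1 : measurable_fun setT phi1) (mphi2 : measurable_fun setT phi2).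
Hypothesis k2_ge0 : (0 <= k2)%R.
Hypothesis phi1E : forall f, measurable_fun setT f -> (forall x, 0 <= f x) ->
  \int[m1]_x f x = k1%:E * \int[m1]_x f (phi1 x).
Hypothesis phi2E : forall f, measurable_fun setT f -> (forall x, 0 <= f x) ->
  \int[m2]_x f x = k2%:E * \int[m2]_x f (phi2 x).

(** By Tonelli, [phi2E] transforms the inner integral and [phi1E] the outer one. Keeping the
    substitutions abstract lets the result be iterated to reach dimension three. *)
Lemma ge0_integral_product_substitution (f : T1 * T2 -> \bar R) :
  measurable_fun setT f -> (forall x, 0 <= f x) ->
  \int[m1 \x m2]_z f z =
  (k1 * k2)%:E * \int[m1 \x m2]_z f (phi1 z.1, phi2 z.2).
Proof.
move=> mf f0.
have mphi : measurable_fun setT (fun z : T1 * T2 => (phi1 z.1, phi2 z.2)).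
  apply/measurable_fun_pairP; split.
    exact: (measurableT_comp mphi1 measurable_fst).
  exact: (measurableT_comp mphi2 measurable_snd).
rewrite !fubini_tonelli1//; last exact: (measurableT_comp mf mphi).
rewrite EFinM -muleA -ge0_integralZl//; last 2 first.
- exact: (measurable_fun_fubini_tonelli_F _ (measurableT_comp mf mphi)
    (fun z => f0 _)).
- by move=> x _; exact: integral_ge0.
rewrite phi1E//; last 2 first.
- exact: measurable_fun_fubini_tonelli_F.
- by move=> x; exact: integral_ge0.
congr (_ * _); apply: eq_integral => x _ /=.
by rewrite /fubini_F/= phi2E//; exact: measurableT_comp.
Qed.

End product_substitution.

Section affine_substitution3.
Context {R : realType}.
Notation mu := (@lebesgue_measure R).
Local Open Scope ereal_scope.

Lemma measurable_affine (h c : R) : measurable_fun [set: R] (fun x => h + c * x)%R.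
Proof. by apply: measurable_funD => //; exact: measurable_funM. Qed.

Lemma ge0_integral_affine3 (h : R3 R) (c : R) (f : R3 R -> \bar R) :
  c != 0%R -> measurable_fun setT f -> (forall x, 0 <= f x) ->
  \int[lebesgue3 R]_x f x =
  (`|c| ^+ 3)%:E * \int[lebesgue3 R]_x f (h + c *: x)%R.
Proof.
move=> c0 mf f0; rewrite exprSr expr2.
have E1 (h' : R) g : measurable_fun setT g -> (forall x, 0 <= g x) ->
    \int[mu]_x g x = `|c|%:E * \int[mu]_x g (h' + c * x)%R.
  exact: ge0_integral_affine.
have m2 : measurable_fun [set: R * R]
    (fun z : R * R => (h.1.1 + c * z.1, h.1.2 + c * z.2)%R).
  apply/measurable_fun_pairP; split.
    exact: (measurableT_comp (measurable_affine _ _) measurable_fst).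
  exact: (measurableT_comp (measurable_affine _ _) measurable_snd).
have E2 g : measurable_fun setT g -> (forall x, 0 <= g x) ->
  \int[lebesgue2 R]_x g x = (`|c| * `|c|)%:E *
     \int[lebesgue2 R]_x g (h.1.1 + c * x.1, h.1.2 + c * x.2)%R.
  move=> mg g0.
  exact: (@ge0_integral_product_substitution _ _ _ _ _ mu mu _ _ _ _
    (measurable_affine h.1.1 c) (measurable_affine h.1.2 c)
    (normr_ge0 c) (E1 _) (E1 _) g mg g0).
have E3 := @ge0_integral_product_substitution _ _ _ _ _ (lebesgue2 R) mu _ _ _ _
  m2 (measurable_affine h.2 c) (normr_ge0 c) E2 (E1 _) f mf f0.
exact: E3.
Qed.

End affine_substitution3.

Section substitution.
Local Open Scope ereal_scope.
Context {d : measure_display} {T : measurableType d} {R : realType}.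
Variables (m : {measure set T -> \bar R}) (phi : T -> T) (k : R).
Hypotheses (mphi : measurable_fun setT phi) (k_gt0 : (0 < k)%R).
Hypothesis phiE : forall f, measurable_fun setT f -> (forall x, 0 <= f x) ->
  \int[m]_x f x = k%:E * \int[m]_x f (phi x).

Lemma integrable_substitution (f : T -> \bar R) :
  m.-integrable setT f -> m.-integrable setT (f \o phi).
Proof.
move=> /integrableP[mf fi]; apply/integrableP; split.
  exact: measurableT_comp mf mphi.
move: fi; rewrite phiE//; last exact: measurableT_comp.
by rewrite -[ltRHS](gt0_muley (_ : 0 < k%:E)) ?lte_fin// lte_pmul2l ?lte_fin.
Qed.

(** The formula for nonnegative functions is applied to the positive and negative parts; the latter
    has a finite integral, so [k] distributes over the difference. *)
Lemma Rintegral_substitution (f : T -> R) :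
  m.-integrable setT (EFin \o f) ->
  (\int[m]_x f x = k * \int[m]_x f (phi x))%R.
Proof.
move=> fi; have mf := measurable_int _ fi.
have fphii := integrable_substitution _ fi.
rewrite /Rintegral -[k in RHS]/(fine k%:E) -fineM//; last first.
  exact: integrable_fin_num fphii.
congr fine.
have -> : \int[m]_x (f (phi x))%:E =
    \int[m]_x (EFin \o f)^\+ (phi x) - \int[m]_x (EFin \o f)^\- (phi x).
  rewrite integralE -[fun x => (f (phi x))%:E]/((EFin \o f) \o phi).
  by rewrite funepos_comp funeneg_comp.
rewrite integralE phiE//; last exact: measurable_funepos.
rewrite [X in _ - X = _]phiE//; last exact: measurable_funeneg.
rewrite [RHS]muleBr//; apply: fin_num_adde_defl; rewrite fin_numN.
by have := integrable_neg_fin_num measurableT fphii; rewrite funeneg_comp.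
Qed.

End substitution.

Section affine_Rintegral.
Context {R : realType}.
Notation mu := (@lebesgue_measure R).

Lemma Rintegral_affine (h c : R) (f : R -> R) : c != 0 ->
  mu.-integrable setT (EFin \o f) ->
  \int[mu]_x f x = `|c| * \int[mu]_x f (h + c * x).
Proof.
move=> c0 fi.
apply: (@Rintegral_substitution _ _ _ mu (fun x => h + c * x) _
    (measurable_affine h c) _ _ f fi).
  by rewrite normr_gt0.
by move=> g mg g0; exact: ge0_integral_affine.
Qed.

Lemma measurable_affine3 (h : R3 R) (c : R) :
  measurable_fun setT (fun x : R3 R => h + c *: x : R3 R).
Proof.
apply/measurable_fun_pairP; split; [apply/measurable_fun_pairP; split|].
- exact: (measurableT_comp (measurable_affine h.1.1 c)
    (measurableT_comp measurable_fst measurable_fst)).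
- exact: (measurableT_comp (measurable_affine h.1.2 c)
    (measurableT_comp measurable_snd measurable_fst)).
- exact: (measurableT_comp (measurable_affine h.2 c) measurable_snd).
Qed.

Lemma integrable_affine3 (h : R3 R) (c : R) (f : R3 R -> R) : c != 0 ->
  (lebesgue3 R).-integrable setT (EFin \o f) ->
  (lebesgue3 R).-integrable setT (fun x => (f (h + c *: x))%:E).
Proof.
move=> c0 fi.
apply: (@integrable_substitution _ _ _ (lebesgue3 R) (fun x => h + c *: x)
    (`|c| ^+ 3) (measurable_affine3 h c) _ _ (EFin \o f) fi).
  by rewrite exprn_gt0// normr_gt0.
by move=> g mg g0; exact: ge0_integral_affine3.
Qed.

Lemma Rintegral_affine3 (h : R3 R) (c : R) (f : R3 R -> R) : c != 0 ->
  (lebesgue3 R).-integrable setT (EFin \o f) ->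
  \int[lebesgue3 R]_x f x =
  `|c| ^+ 3 * \int[lebesgue3 R]_x f (h + c *: x).
Proof.
move=> c0 fi.
apply: (@Rintegral_substitution _ _ _ (lebesgue3 R) (fun x => h + c *: x) _
    (measurable_affine3 h c) _ _ f fi).
  by rewrite exprn_gt0// normr_gt0.
by move=> g mg g0; exact: ge0_integral_affine3.
Qed.

End affine_Rintegral.

Section product_Rintegral.
Context {d1 d2 : measure_display} {T1 : measurableType d1}
  {T2 : measurableType d2} {R : realType}.
Variables (m1 : {sigma_finite_measure set T1 -> \bar R})
  (m2 : {sigma_finite_measure set T2 -> \bar R}).

Lemma integrable_product (u : T1 -> R) (v : T2 -> R) :
  m1.-integrable setT (EFin \o u) -> m2.-integrable setT (EFin \o v) ->
  (m1 \x m2)%E.-integrable setT (fun z => (u z.1 * v z.2)%:E).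
Proof.
move=> iu iv.
have /measurable_EFinP mu := measurable_int _ iu.
have /measurable_EFinP mv := measurable_int _ iv.
have muv : measurable_fun setT (fun z : T1 * T2 => (u z.1 * v z.2)%:E).
  apply/measurable_EFinP; apply: measurable_funM.
    exact: (measurableT_comp mu measurable_fst).
  exact: (measurableT_comp mv measurable_snd).
apply/(integrable12ltyP _ _ muv) => /=.
under eq_integral.
  move=> x _.
  under eq_integral do rewrite normrM EFinM.
  rewrite ge0_integralZl//=; last exact/measurable_EFinP/measurableT_comp.
  over.
rewrite ge0_integralZr//=; last 2 first.
- exact/measurable_EFinP/measurableT_comp.
- exact: integral_ge0.
move/integrableP: iu => [_ iu]; move/integrableP: iv => [_ iv].
by rewrite lte_mul_pinfty//; [exact: integral_ge0|
  rewrite ge0_fin_numE//; exact: integral_ge0].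
Qed.

Lemma Rintegral_product (u : T1 -> R) (v : T2 -> R) :
  m1.-integrable setT (EFin \o u) -> m2.-integrable setT (EFin \o v) ->
  \int[(m1 \x m2)%E]_z (u z.1 * v z.2) =
  (\int[m1]_x u x) * (\int[m2]_y v y).
Proof.
move=> iu iv; rewrite /Rintegral -fineM; [|exact: integrable_fin_num iu|
  exact: integrable_fin_num iv].
congr fine; rewrite -integral12_prod_meas1; last exact: integrable_product.
have fv := integrable_fin_num measurableT iv.
rewrite -(fineK fv) -integralZr//; apply: eq_integral => x _ /=.
rewrite /fubini_F/=; under eq_integral do rewrite EFinM.
by rewrite integralZl// fineK.
Qed.

End product_Rintegral.

(** * Exponential and Cauchy kernels *)

Section trig_factor.
Context {d : measure_display} {T : measurableType d} {R : realType}.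
Variables (m : {measure set T -> \bar R}) (f : T -> R).
Hypothesis fi : m.-integrable setT (EFin \o f).

Lemma integrableM_cst (k : R) : m.-integrable setT (fun x => (k * f x)%:E).
Proof. by under eq_fun do rewrite EFinM; exact: integrableZl. Qed.

Lemma integrableM_bounded (M : R) (h : T -> R) : measurable_fun setT h ->
  (forall x, `|h x| <= M) -> m.-integrable setT (fun x => (f x * h x)%:E).
Proof.
move=> mh hM.
have /measurable_EFinP mf := measurable_int _ fi.
apply: (@le_integrable _ _ _ _ _ measurableT _ (fun x => (M%:E * (f x)%:E)%E)).
- by apply/measurable_EFinP; exact: measurable_funM.
- move=> x _; rewrite -EFinM /= lee_fin !normrM mulrC ler_wpM2r//.
  by rewrite (le_trans (hM x))// ler_norm.
- exact: integrableZl.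
Qed.

Lemma integrableM_cos (th : T -> R) : measurable_fun setT th ->
  m.-integrable setT (fun x => (f x * cos (th x))%:E).
Proof.
move=> mth; apply: (integrableM_bounded 1).
  apply: measurableT_comp => //.
  exact: (continuous_measurable_fun (@continuous_cos R)).
by move=> x; rewrite ler_norml cos_geN1 cos_le1.
Qed.

Lemma integrableM_sin (th : T -> R) : measurable_fun setT th ->
  m.-integrable setT (fun x => (f x * sin (th x))%:E).
Proof.
move=> mth; apply: (integrableM_bounded 1).
  apply: measurableT_comp => //.
  exact: (continuous_measurable_fun (@continuous_sin R)).
by move=> x; rewrite ler_norml sin_geN1 sin_le1.
Qed.

End trig_factor.

Section product_trig.
Context {d1 d2 : measure_display} {T1 : measurableType d1}
  {T2 : measurableType d2} {R : realType}.
Variables (m1 : {sigma_finite_measure set T1 -> \bar R})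
  (m2 : {sigma_finite_measure set T2 -> \bar R}).
Variables (w1 th1 : T1 -> R) (w2 th2 : T2 -> R).
Hypotheses (iw1 : m1.-integrable setT (EFin \o w1))
  (iw2 : m2.-integrable setT (EFin \o w2)).
Hypotheses (mth1 : measurable_fun setT th1) (mth2 : measurable_fun setT th2).
Hypotheses (sin1 : \int[m1]_x (w1 x * sin (th1 x)) = 0)
  (sin2 : \int[m2]_x (w2 x * sin (th2 x)) = 0).

Let c1 x := w1 x * cos (th1 x).
Let s1 x := w1 x * sin (th1 x).
Let c2 x := w2 x * cos (th2 x).
Let s2 x := w2 x * sin (th2 x).
Let ic1 := integrableM_cos m1 w1 iw1 th1 mth1.
Let is1 := integrableM_sin m1 w1 iw1 th1 mth1.
Let ic2 := integrableM_cos m2 w2 iw2 th2 mth2.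
Let is2 := integrableM_sin m2 w2 iw2 th2 mth2.

(** The addition formula gives the product of the cosine integrals minus that of the sine integrals,
    and the second product vanishes. *)
Lemma Rintegral_product_cos :
  \int[(m1 \x m2)%E]_z (w1 z.1 * w2 z.2 * cos (th1 z.1 + th2 z.2)) =
  (\int[m1]_x (w1 x * cos (th1 x))) * (\int[m2]_x (w2 x * cos (th2 x))).
Proof.
transitivity (\int[(m1 \x m2)%E]_z
    (w1 z.1 * cos (th1 z.1) * (w2 z.2 * cos (th2 z.2)) -
     w1 z.1 * sin (th1 z.1) * (w2 z.2 * sin (th2 z.2)))).
  by apply: eq_Rintegral => z _; rewrite cosD; ring.
rewrite RintegralB//; [|exact: (integrable_product _ _ c1 c2)
  |exact: (integrable_product _ _ s1 s2)].
by rewrite (Rintegral_product _ _ s1 s2)// (Rintegral_product _ _ c1 c2)//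
  sin1 mul0r subr0.
Qed.

(** Each term of the addition formula contains a vanishing sine integral. This supplies the
    hypothesis [sin1] when a further factor is added. *)
Lemma Rintegral_product_sin :
  \int[(m1 \x m2)%E]_z (w1 z.1 * w2 z.2 * sin (th1 z.1 + th2 z.2)) = 0.
Proof.
transitivity (\int[(m1 \x m2)%E]_z
    (w1 z.1 * sin (th1 z.1) * (w2 z.2 * cos (th2 z.2)) +
     w1 z.1 * cos (th1 z.1) * (w2 z.2 * sin (th2 z.2)))).
  by apply: eq_Rintegral => z _; rewrite sinD; ring.
rewrite RintegralD//; [|exact: (integrable_product _ _ s1 c2)
  |exact: (integrable_product _ _ c1 s2)].
rewrite (Rintegral_product _ _ s1 c2)// (Rintegral_product _ _ c1 s2)//.
by rewrite sin1 sin2 mul0r mulr0 addr0.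
Qed.

End product_trig.

Section exponential_kernel.
Context {R : realType}.
Notation mu := (@lebesgue_measure R).

Let w (x : R) := expR (- `|x|).

Let continuous_w : continuous w.
Proof.
move=> x; apply: (@continuous_comp _ _ _ (fun x : R => - `|x|) expR).
  by apply: cvgN; exact: norm_continuous.
exact: continuous_expR.
Qed.

(** A primitive of exp(-x) (1 + cos(u x)). The summand 1 keeps the integrand nonnegative, as the
    fundamental theorem on a half-line used below requires; it is subtracted again at the end. *)
Let primitive (u x : R) : R :=
  - expR (- x) + expR (- x) * (u * sin (u * x) - cos (u * x)) / (1 + u ^+ 2).

Let u_gt0 (u : R) : 0 < 1 + u ^+ 2.
Proof. by rewrite ltr_pwDl// sqr_ge0. Qed.

Let is_derive_primitive (u x : R) :
  is_derive x 1 (primitive u) (expR (- x) * (1 + cos (u * x))).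
Proof.
have u0 := lt0r_neq0 (u_gt0 u).
have dM : is_derive x 1 (fun y : R => u * y) u.
  rewrite (_ : (fun y => u * y) = u \*: id)//; apply: is_derive_eq.
  by rewrite /GRing.scale/= mulr1.
have dE : is_derive x 1 (fun y : R => expR (- y)) (- expR (- x)).
  rewrite -mulrN1.
  exact: (is_derive1_comp (is_derive_expR (- x)) (is_deriveNid x 1)).
have dS : is_derive x 1 (fun y : R => sin (u * y)) (cos (u * x) * u).
  exact: (is_derive1_comp (is_derive_sin (u * x)) dM).
have dC : is_derive x 1 (fun y : R => cos (u * y)) (- sin (u * x) * u).
  exact: (is_derive1_comp (is_derive_cos (u * x)) dM).
have dZ (k : R) f df : is_derive x 1 f df ->
    is_derive x 1 (fun y : R => k * f y) (k * df) by exact: is_deriveZ.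
have dD : is_derive x 1 (fun y : R => u * sin (u * y) - cos (u * y))
    (u * (cos (u * x) * u) - - sin (u * x) * u).
  exact: (is_deriveB (dZ u _ _ dS) dC).
have dP : is_derive x 1
    (fun y : R => expR (- y) * (u * sin (u * y) - cos (u * y)))
    (expR (- x) * (u * (cos (u * x) * u) - - sin (u * x) * u) +
     (u * sin (u * x) - cos (u * x)) * - expR (- x)).
  exact: (is_deriveM dE dD).
have := is_deriveD (is_deriveN dE) (dZ (1 + u ^+ 2)^-1 _ _ dP).
rewrite (_ : _ + _ = primitive u); last first.
  by apply/funext => y; rewrite /primitive [RHS]/= [in RHS]mulrC.
by congr is_derive; field.
Qed.

Let primitive_cvg u : primitive u x @[x --> +oo] --> 0.
Proof.
have c0 (M : R) : M * expR (- x) @[x --> +oo] --> 0.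
  by rewrite -(mulr0 M); apply: cvgMl_tmp; exact: cvgr_expR.
(* The coefficient of exp(-x) is bounded by 1 + (1 + |u|) / (1 + u^2), hence by 2 + |u|. *)
apply: (squeeze_cvgr _ (c0 (- (2 + `|u|))) (c0 (2 + `|u|))).
near=> x.
have -> : primitive u x =
    (-1 + (u * sin (u * x) - cos (u * x)) / (1 + u ^+ 2)) * expR (- x).
  by rewrite /primitive; ring.
rewrite mulNr -ler_norml normrM (ger0_norm (expR_ge0 _)).
rewrite ler_pM2r ?expR_gt0//.
rewrite (le_trans (ler_normD _ _))// normrN1 (_ : 2 = 1 + 1)// -addrA lerD2l.
rewrite normrM normfV (ger0_norm (ltW (u_gt0 u))) ler_pdivrMr//.
rewrite (@le_trans _ _ (1 + `|u|))//; last first.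
  by rewrite ler_peMr ?addr_ge0// lerDl sqr_ge0.
rewrite (le_trans (ler_normB _ _))// addrC lerD//.
  by rewrite ler_norml cos_geN1 cos_le1.
by rewrite normrM ler_piMr// ler_norml sin_geN1 sin_le1.
Unshelve. all: by end_near. Qed.

Let continuous_1cos u : continuous (fun x : R => 1 + cos (u * x)).
Proof.
move=> x; apply: cvgD; first exact: cvg_cst.
apply: (@continuous_comp _ _ _ (fun x : R => u * x) cos).
  by apply: cvgMl_tmp; exact: cvg_id.
exact: continuous_cos.
Qed.

Let integral_half u :
  (\int[mu]_(x in `[0%R, +oo[) (expR (- x) * (1 + cos (u * x)))%:E =
   (1 + (1 + u ^+ 2)^-1)%:E)%E.
Proof.
have cf : continuous (fun x : R => expR (- x) * (1 + cos (u * x))).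
  move=> x; apply: cvgM; last exact: continuous_1cos.
  apply: (@continuous_comp _ _ _ (fun x : R => - x) expR).
    by apply: cvgN; exact: cvg_id.
  exact: continuous_expR.
rewrite (ge0_continuous_FTC2y _ _ (primitive_cvg u)).
- rewrite sub0e /primitive !(oppr0,mulr0,sin0,cos0,expR0) sub0r !mul1r mulN1r.
  by rewrite -opprD EFinN oppeK.
- by move=> x _; rewrite mulr_ge0 ?expR_ge0// -lerBlDl sub0r cos_geN1.
- exact: continuous_subspaceT.
- by move=> x _; exact: ex_derive.
- apply: cvg_at_right_filter; apply: differentiable_continuous.
  exact/derivable1_diffP/ex_derive.
- by move=> x _; rewrite derive1E; exact: derive_val.
Qed.

Let integral_cos1 u :
  (\int[mu]_x (w x * (1 + cos (u * x)))%:E = (2 * (1 + (1 + u ^+ 2)^-1))%:E)%E.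
Proof.
rewrite ge0_symfun_integralT.
- rewrite EFinM -integral_half -set_itvcy; congr (_ * _)%E.
  by apply: eq_integral => x; rewrite inE/= in_itv/= andbT /w => /ger0_norm->.
- by move=> x; rewrite mulr_ge0 ?expR_ge0// -lerBlDl sub0r cos_geN1.
- by move=> x; apply: cvgM; [exact: continuous_w|exact: continuous_1cos].
- by move=> x /=; rewrite /w normrN mulrN cosN.
Qed.

Let mw : measurable_fun setT w.
Proof. exact: continuous_measurable_fun. Qed.

Let integral_w : (\int[mu]_x (w x)%:E = 2%:E)%E.
Proof.
(* At [u = 0] the factor 1 + cos(u x) is 2 and the right-hand side is 4. *)
have := integral_cos1 0.
have -> : (\int[mu]_x (w x * (1 + cos (0 * x)))%:E = 2%:E * \int[mu]_x (w x)%:E)%E.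
  rewrite -ge0_integralZl_EFin//; last 2 first.
  - by move=> x _; rewrite lee_fin expR_ge0.
  - exact/measurable_EFinP.
  by apply: eq_integral => x _; rewrite mul0r cos0 mulrC EFinM.
move=> /(congr1 (fun e => (2^-1)%:E * e)%E).
rewrite muleA -!EFinM mulVf// mul1e => ->; congr EFin.
by rewrite expr0n/= addr0 invr1; field.
Qed.

Lemma integrable_exp_norm : mu.-integrable setT (EFin \o (fun x => expR (- `|x|))).
Proof.
apply/integrableP; split; first exact/measurable_EFinP.
under eq_integral do rewrite gee0_abs ?lee_fin ?expR_ge0//.
by rewrite integral_w ltry.
Qed.

Let mZ (u : R) : measurable_fun setT (fun x : R => u * x).
Proof. exact: measurable_funM. Qed.

Lemma Rintegral_exp_norm_cos (u : R) :
  \int[mu]_x (expR (- `|x|) * cos (u * x)) = 2 * (1 + u ^+ 2)^-1.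
Proof.
have := congr1 fine (integral_cos1 u).
rewrite -[LHS]/(\int[mu]_x (w x * (1 + cos (u * x)))) /=.
under eq_Rintegral do rewrite mulrDr mulr1.
have ic := integrableM_cos mu w integrable_exp_norm _ (mZ u).
rewrite RintegralD//; last exact: integrable_exp_norm.
rewrite {1}/Rintegral integral_w/= mulrDr mulr1.
by move/addrI.
Qed.

(** The integrand is odd, so the reflection x -> -x shows that the integral is its own opposite. *)
Lemma Rintegral_exp_norm_sin (u : R) :
  \int[mu]_x (expR (- `|x|) * sin (u * x)) = 0.
Proof.
have is_ := integrableM_sin mu w integrable_exp_norm _ (mZ u).
have N1 : -1 != 0 :> R by rewrite oppr_eq0 oner_eq0.
have := Rintegral_affine 0 (-1) (fun x => w x * sin (u * x)) N1 is_.
rewrite normrN1 mul1r.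
under [X in _ = X -> _]eq_Rintegral.
  move=> x _; rewrite add0r mulN1r /w normrN mulrN sinN mulrN -mulN1r.
  over.
rewrite /= RintegralZl//.
by rewrite mulN1r /w => /eqP; rewrite -addr_eq0 -mulr2n mulrn_eq0/= => /eqP.
Qed.

End exponential_kernel.

Section cauchy_kernel.
Context {R : realType}.
Notation mu := (@lebesgue_measure R).

(** The Fourier transform of exp(-|x|), left unnormalised: its total mass is 2 pi. *)
Definition cauchy_kernel (u : R) : R := 2 * (oneDsqr u)^-1.

Let cauchy_kernel_ge0 u : 0 <= cauchy_kernel u.
Proof. by rewrite mulr_ge0// invr_ge0 (le_trans ler01)// oneDsqr_ge1. Qed.

Let continuous_cauchy_kernel : continuous cauchy_kernel.
Proof. by move=> u; apply: cvgMl_tmp; exact: continuous_oneDsqrV. Qed.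

Let integral_cauchy_kernel : (\int[mu]_u (cauchy_kernel u)%:E = (2 * pi)%:E)%E.
Proof.
rewrite ge0_symfun_integralT//; last first.
  by move=> u; rewrite /cauchy_kernel/= /oneDsqr sqrrN.
rewrite -set_itvcy /cauchy_kernel.
under eq_integral do rewrite EFinM.
rewrite ge0_integralZl_EFin//; last first.
  apply/measurable_EFinP/measurable_funTS; apply: continuous_measurable_fun.
  exact: continuous_oneDsqrV.
by rewrite integral0y_oneDsqr -!EFinM; congr EFin; field.
Qed.

Lemma integrable_cauchy_kernel : mu.-integrable setT (EFin \o cauchy_kernel).
Proof.
apply/integrableP; split.
  by apply/measurable_EFinP; exact: continuous_measurable_fun.
under eq_integral do rewrite gee0_abs ?lee_fin//.
by rewrite integral_cauchy_kernel ltry.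
Qed.

Lemma Rintegral_cauchy_kernel : \int[mu]_u cauchy_kernel u = 2 * pi.
Proof. by rewrite /Rintegral integral_cauchy_kernel. Qed.

End cauchy_kernel.

Section kernel3.
Context {R : realType}.
Notation mu := (@lebesgue_measure R).

(** The weight [W] of the overview. Being a product of one-variable kernels, it has an explicit
    transform, the product Cauchy kernel. *)
Definition exp_kernel3 (p : R3 R) : R :=
  expR (- `|p.1.1|) * expR (- `|p.1.2|) * expR (- `|p.2|).

Definition cauchy_kernel3 (u : R3 R) : R :=
  cauchy_kernel u.1.1 * cauchy_kernel u.1.2 * cauchy_kernel u.2.

Lemma integrable_exp_kernel3 :
  (lebesgue3 R).-integrable setT (EFin \o exp_kernel3).
Proof.
have i1 := @integrable_exp_norm R.
have i2 := integrable_product mu mu _ _ i1 i1.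
exact: (integrable_product (lebesgue2 R) mu
  (fun p => expR (- `|p.1|) * expR (- `|p.2|)) _ i2 i1).
Qed.

Lemma integrable_cauchy_kernel3 :
  (lebesgue3 R).-integrable setT (EFin \o cauchy_kernel3).
Proof.
have i1 := @integrable_cauchy_kernel R.
have i2 := integrable_product mu mu _ _ i1 i1.
exact: (integrable_product (lebesgue2 R) mu
  (fun p => cauchy_kernel p.1 * cauchy_kernel p.2) _ i2 i1).
Qed.

Lemma Rintegral_cauchy_kernel3 :
  \int[lebesgue3 R]_u cauchy_kernel3 u = (2 * pi) ^+ 3.
Proof.
have i1 := @integrable_cauchy_kernel R.
have i2 := integrable_product mu mu _ _ i1 i1.
have E2 := Rintegral_product mu mu _ _ i1 i1.
have E3 := Rintegral_product (lebesgue2 R) mu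
  (fun p => cauchy_kernel p.1 * cauchy_kernel p.2) _ i2 i1.
rewrite [LHS]E3 [X in X * _]E2 Rintegral_cauchy_kernel.
by rewrite exprSr expr2.
Qed.

Lemma Rintegral_exp_kernel3_cos (u : R3 R) :
  \int[lebesgue3 R]_p (exp_kernel3 p * cos (dot3 p u)) = cauchy_kernel3 u.
Proof.
have i1 := @integrable_exp_norm R.
have i2 := integrable_product mu mu _ _ i1 i1.
have mZ (v : R) : measurable_fun [set: R] (fun x : R => v * x).
  exact: measurable_funM.
have c2 := Rintegral_product_cos mu mu _ _ _ _ i1 i1 (mZ u.1.1) (mZ u.1.2)
  (Rintegral_exp_norm_sin _).
have s2 := Rintegral_product_sin mu mu _ _ _ _ i1 i1 (mZ u.1.1) (mZ u.1.2)
  (Rintegral_exp_norm_sin _) (Rintegral_exp_norm_sin _).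
have m2 : measurable_fun [set: R * R]
    (fun z : R * R => u.1.1 * z.1 + u.1.2 * z.2).
  apply: measurable_funD.
    exact: (measurableT_comp (mZ _) measurable_fst).
  exact: (measurableT_comp (mZ _) measurable_snd).
have c3 := Rintegral_product_cos (lebesgue2 R) mu _ _ _ _ i2 i1 m2 (mZ u.2)
  s2.
rewrite (_ : cauchy_kernel3 u = (\int[mu]_x (expR (- `|x|) * cos (u.1.1 * x))) *
  (\int[mu]_x (expR (- `|x|) * cos (u.1.2 * x))) *
  \int[mu]_x (expR (- `|x|) * cos (u.2 * x))); last first.
  by rewrite !Rintegral_exp_norm_cos.
rewrite -[X in _ = X * _]c2 -[RHS]c3.
apply: eq_Rintegral => p _; rewrite /exp_kernel3 /dot3.
by rewrite ![_ * p.1.1]mulrC ![_ * p.1.2]mulrC ![_ * p.2]mulrC.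
Qed.

End kernel3.

(** * Fubini's theorem for real-valued integrals *)

Section Rintegral_Fubini.
Context {d1 d2 : measure_display} {T1 : measurableType d1}
  {T2 : measurableType d2} {R : realType}.
Variables (m1 : {sigma_finite_measure set T1 -> \bar R})
  (m2 : {sigma_finite_measure set T2 -> \bar R}) (f : T1 * T2 -> R).
Hypothesis fi : (m1 \x m2)%E.-integrable setT (EFin \o f).
Hypothesis fi1 : forall x, m2.-integrable setT (fun y => (f (x, y))%:E).
Hypothesis fi2 : forall y, m1.-integrable setT (fun x => (f (x, y))%:E).

(** Every section is integrable, not just almost every one, so the extended inner integrals are
    finite at each point and coincide with the real ones. *)
Let FE x : (\int[m2]_y (f (x, y))%:E = (\int[m2]_y f (x, y))%:E)%E.
Proof. by rewrite /Rintegral fineK//; exact: integrable_fin_num (fi1 x). Qed.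

Let GE y : (\int[m1]_x (f (x, y))%:E = (\int[m1]_x f (x, y))%:E)%E.
Proof. by rewrite /Rintegral fineK//; exact: integrable_fin_num (fi2 y). Qed.

Lemma integrable_Rintegral1 :
  m1.-integrable setT (fun x => (\int[m2]_y f (x, y))%:E).
Proof.
rewrite (_ : (fun x => _) = fubini_F m2 (EFin \o f)).
  exact: (@integrable_fubini_F _ _ _ _ _ m1 m2 _ fi).
by apply/funext => x; rewrite -FE.
Qed.

Lemma Rintegral_Fubini :
  \int[m1]_x \int[m2]_y f (x, y) = \int[m2]_y \int[m1]_x f (x, y).
Proof.
have := congr1 fine (@Fubini _ _ _ _ _ m1 m2 _ fi).
under eq_integral do rewrite FE.
by under [in X in _ = X -> _]eq_integral do rewrite GE.
Qed.

End Rintegral_Fubini.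

(** * The scalar product on three-space *)

Section dot3.
Context {R : realType}.
Implicit Types (p q v : R3 R) (c : R).

Lemma measurable_dot3 :
  measurable_fun setT (fun z : R3 R * R3 R => dot3 z.1 z.2).
Proof.
have m1 : measurable_fun setT (fun z : R3 R => z.1.1).
  exact: (measurableT_comp measurable_fst measurable_fst).
have m2 : measurable_fun setT (fun z : R3 R => z.1.2).
  exact: (measurableT_comp measurable_snd measurable_fst).
have m3 : measurable_fun setT (fun z : R3 R => z.2) by exact: measurable_snd.
have mf h : measurable_fun setT h ->
    measurable_fun setT (fun z : R3 R * R3 R => h z.1 : R).
  by move=> mh; exact: (measurableT_comp mh measurable_fst).
have ms h : measurable_fun setT h ->
    measurable_fun setT (fun z : R3 R * R3 R => h z.2 : R).
  by move=> mh; exact: (measurableT_comp mh measurable_snd).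
by apply: measurable_funD; [apply: measurable_funD|];
  apply: measurable_funM; [exact: (mf _ m1)|exact: (ms _ m1)
    |exact: (mf _ m2)|exact: (ms _ m2)|exact: (mf _ m3)|exact: (ms _ m3)].
Qed.

Lemma dot3C p q : dot3 p q = dot3 q p.
Proof. by rewrite /dot3; ring. Qed.

Lemma dot3D p q v : dot3 p (q + v) = dot3 p q + dot3 p v.
Proof. by rewrite /dot3/=; ring. Qed.

Lemma dot3Zr c p q : dot3 p (c *: q) = c * dot3 p q.
Proof. by rewrite /dot3/= -![_ *: _]/(_ * _); ring. Qed.

Lemma dot3Zl c p q : dot3 (c *: p) q = c * dot3 p q.
Proof. by rewrite dot3C dot3Zr dot3C. Qed.

Lemma dot3N p q : dot3 p (- q) = - dot3 p q.
Proof. by rewrite /dot3/=; ring. Qed.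

Lemma dot30 p : dot3 p 0 = 0.
Proof. by rewrite /dot3/= !mulr0 !addr0. Qed.

Lemma measurable_dot3r p : measurable_fun setT (dot3 p).
Proof. exact: (measurableT_comp measurable_dot3 (pair1_measurable p)). Qed.

Lemma measurable_dot3l q : measurable_fun setT (fun p => dot3 p q).
Proof. exact: (measurableT_comp measurable_dot3 (pair2_measurable q)). Qed.

End dot3.

(** * Fourier inversion *)

(* [phi] is the inverse Fourier transform of [g], in real notation: the sine
   condition says that the imaginary part vanishes. *)
Record fourier_pair {R : realType} (g phi : R3 R -> R) : Prop := FourierPair {
  fourier_integrable : (lebesgue3 R).-integrable setT (EFin \o g);
  fourier_continuous : continuous g;
  fourier_le1 : forall eta, `|g eta| <= 1;
  fourier_cos : forall p,
    phi p = (2 * pi) ^- 3 * \int[lebesgue3 R]_eta (g eta * cos (dot3 p eta));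
  fourier_sin : forall p,
    \int[lebesgue3 R]_eta (g eta * sin (dot3 p eta)) = 0;
  inverse_fourier_ge0 : forall p, 0 <= phi p }.

Section fourier_inversion.
Context {R : realType}.
Notation mu3 := (lebesgue3 R).
Variables (g phi : R3 R -> R).
Hypothesis gphi : fourier_pair g phi.

Let gi := fourier_integrable _ _ gphi.
Let g_cont := fourier_continuous _ _ gphi.
Let g_le1 := fourier_le1 _ _ gphi.
Let phi_cos := fourier_cos _ _ gphi.
Let phi_sin := fourier_sin _ _ gphi.
Let phi_ge0 := inverse_fourier_ge0 _ _ gphi.

Let mg : measurable_fun setT g.
Proof. by apply/measurable_EFinP; exact: measurable_int gi. Qed.

Let twopi3_neq0 : (2 * pi) ^+ 3 != 0 :> R.
Proof. by rewrite expf_neq0// mulf_neq0// gt_eqF// pi_gt0. Qed.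

Lemma fourier_cosE p : \int[mu3]_eta (g eta * cos (dot3 p eta)) = (2 * pi) ^+ 3 * phi p.
Proof. by rewrite phi_cos mulrA divff// mul1r. Qed.

(** A damping factor: integrable for [e > 0], and increasing to 1 along [e = 1 / (n + 1)]. *)
Let W (e : R) (p : R3 R) := exp_kernel3 (e *: p).

Let iW e : 0 < e -> mu3.-integrable setT (EFin \o W e).
Proof.
move=> e0; have := integrable_affine3 0 e exp_kernel3 (lt0r_neq0 e0)
  integrable_exp_kernel3.
by under eq_fun do rewrite add0r.
Qed.

Let mW e : 0 < e -> measurable_fun setT (W e).
Proof. by move=> e0; apply/measurable_EFinP; exact: measurable_int (iW e e0). Qed.

Let W_gt0 e p : 0 < W e p.
Proof. by rewrite /W /exp_kernel3 !mulr_gt0 ?expR_gt0. Qed.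

Let WE e p : 0 < e -> W e p = expR (- (e * (`|p.1.1| + `|p.1.2| + `|p.2|))).
Proof.
move=> e0; rewrite /W /exp_kernel3 -!expRD/= -![_ *: _]/(_ * _) !normrM gtr0_norm//.
by congr expR; ring.
Qed.

(** Integrating first in the frequency [z.2] produces the damped integrand of the inversion formula
    ([f1]); integrating first in [z.1] produces a Cauchy kernel around [eta] ([f2]). *)
Let f e eta (z : R3 R * R3 R) : R :=
  W e z.1 * g z.2 * cos (dot3 z.1 (z.2 - eta)).

Let fi e eta : 0 < e -> (mu3 \x mu3)%E.-integrable setT (EFin \o f e eta).
Proof.
move=> e0.
apply: (integrableM_cos (mu3 \x mu3)%E (fun z => W e z.1 * g z.2)
  (integrable_product mu3 mu3 _ _ (iW e e0) gi) (fun z => dot3 z.1 (z.2 - eta))).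
under eq_fun do rewrite dot3D.
apply: measurable_funD; first exact: measurable_dot3.
exact: (measurableT_comp (measurable_dot3l (- eta)) measurable_fst).
Qed.

Let fi1 e eta : 0 < e -> forall p,
  mu3.-integrable setT (fun zeta => (f e eta (p, zeta))%:E).
Proof.
move=> e0 p; rewrite /f/=.
under eq_fun do rewrite -mulrA EFinM.
apply: integrableZl => //.
apply: (integrableM_cos mu3 g gi (fun zeta => dot3 p (zeta - eta))).
under eq_fun do rewrite dot3D.
by apply: measurable_funD => //; exact: measurable_dot3r.
Qed.

Let fi2 e eta : 0 < e -> forall zeta,
  mu3.-integrable setT (fun p => (f e eta (p, zeta))%:E).
Proof.
move=> e0 zeta; rewrite /f/=.
under eq_fun do rewrite (mulrC (W _ _)) -mulrA EFinM.
apply: integrableZl => //.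
exact: (integrableM_cos mu3 (W e) (iW e e0) _ (measurable_dot3l _)).
Qed.

(** Once the cosine of the difference is expanded, the sine part drops out by [phi_sin]. *)
Let f1 e eta p :
  \int[mu3]_zeta f e eta (p, zeta) =
  (2 * pi) ^+ 3 * (W e p * phi p * cos (dot3 p eta)).
Proof.
have ic := integrableM_cos mu3 g gi _ (measurable_dot3r p).
have is_ := integrableM_sin mu3 g gi _ (measurable_dot3r p).
transitivity (\int[mu3]_zeta (W e p * cos (dot3 p eta) * (g zeta * cos (dot3 p zeta))
    + W e p * sin (dot3 p eta) * (g zeta * sin (dot3 p zeta)))).
  apply: eq_Rintegral => zeta _.
  by rewrite /f/= dot3D dot3N cosB; ring.
rewrite RintegralD//; [|exact: (integrableM_cst mu3 _ ic)
  |exact: (integrableM_cst mu3 _ is_)].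
by rewrite !RintegralZl// phi_sin fourier_cosE; ring.
Qed.

(** Rescaling by [e] turns [W e] into [exp_kernel3], whose transform is taken at (zeta - eta) / e.
    That point is written in affine form to match the next substitution. *)
Let f2 e eta zeta : 0 < e ->
  \int[mu3]_p f e eta (p, zeta) =
  e ^- 3 * (g zeta * cauchy_kernel3 (- (e^-1 *: eta) + e^-1 *: zeta)).
Proof.
move=> e0.
have iWc := integrableM_cos mu3 exp_kernel3 integrable_exp_kernel3 _
  (measurable_dot3l (- (e^-1 *: eta) + e^-1 *: zeta)).
rewrite -Rintegral_exp_kernel3_cos.
rewrite (Rintegral_affine3 0 e _ (lt0r_neq0 e0) iWc) gtr0_norm//.
transitivity (g zeta * \int[mu3]_p (W e p * cos (dot3 p (zeta - eta)))).
  rewrite -RintegralZl//.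
    by apply: eq_Rintegral => p _; rewrite /f/=; ring.
  exact: (integrableM_cos mu3 (W e) (iW e e0) _ (measurable_dot3l _)).
rewrite [RHS]mulrCA mulKf ?expf_neq0 ?lt0r_neq0//.
congr (_ * _); apply: eq_Rintegral => p _; rewrite add0r; congr (_ * cos _).
rewrite dot3Zl !dot3D !dot3N !dot3Zr.
by field; exact: lt0r_neq0.
Qed.

Let integrable_gK (e : R) eta :
  mu3.-integrable setT (fun u => (g (eta + e *: u) * cauchy_kernel3 u)%:E).
Proof.
under eq_fun do rewrite mulrC.
apply: (integrableM_bounded mu3 cauchy_kernel3 integrable_cauchy_kernel3 1) => //.
exact: (measurableT_comp mg (measurable_affine3 eta e)).
Qed.

(** Fubini equates the two iterated integrals of [f e eta]; the substitution zeta = eta + e u then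
    absorbs the factor e^-3. *)
Lemma fourier_mollification e eta : 0 < e ->
  mu3.-integrable setT (fun p => (W e p * phi p * cos (dot3 p eta))%:E) /\
  \int[mu3]_p (W e p * phi p * cos (dot3 p eta)) =
  (2 * pi) ^- 3 * \int[mu3]_u (g (eta + e *: u) * cauchy_kernel3 u).
Proof.
move=> e0.
have i1 := integrable_Rintegral1 mu3 mu3 _ (fi e eta e0) (fi1 e eta e0).
have F := Rintegral_Fubini mu3 mu3 _ (fi e eta e0) (fi1 e eta e0) (fi2 e eta e0).
have i1' : mu3.-integrable setT (fun p => (W e p * phi p * cos (dot3 p eta))%:E).
  rewrite (_ : (fun p => _) = (fun p => ((2 * pi) ^- 3 *
      \int[mu3]_zeta f e eta (p, zeta))%:E)).
    exact: (integrableM_cst mu3 (fun p => \int[mu3]_zeta f e eta (p, zeta)) i1).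
  by apply/funext => p; rewrite f1 mulKf.
split => //.
have iK := integrable_gK e eta.
have ei0 : e^-1 != 0 by rewrite invr_neq0 ?lt0r_neq0.
rewrite (Rintegral_affine3 (- (e^-1 *: eta)) e^-1 _ ei0 iK).
rewrite gtr0_norm ?invr_gt0// exprVn.
have e30 : e ^+ 3 != 0 by rewrite expf_neq0 ?lt0r_neq0.
have affK zeta : eta + e *: (- (e^-1 *: eta) + e^-1 *: zeta) = zeta.
  rewrite scalerDr scalerN !scalerA divff ?lt0r_neq0// !scale1r.
  by rewrite addrA subrr add0r.
have <- : \int[mu3]_y \int[mu3]_x f e eta (x, y) = e ^- 3 * \int[mu3]_x
    (g (eta + e *: (- (e^-1 *: eta) + e^-1 *: x)) *
      cauchy_kernel3 (- (e^-1 *: eta) + e^-1 *: x)).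
  under eq_Rintegral do rewrite f2//.
  under [in RHS]eq_Rintegral do rewrite affK.
  rewrite RintegralZl//.
  have := integrable_affine3 (- (e^-1 *: eta)) e^-1 _ ei0 iK.
  by apply: eq_integrable => // zeta _; rewrite affK.
rewrite -F -RintegralZl//.
by apply: eq_Rintegral => p _; rewrite f1 mulKf.
Qed.

Lemma measurable_inverse_fourier : measurable_fun setT phi.
Proof.
have [/measurable_int/measurable_EFinP mWphi _] := fourier_mollification 1 0 ltr01.
(* Fubini yields measurability of the damped function; dividing by [W 1], with the reciprocal
   written as an exponential, gives that of [phi]. *)
rewrite (_ : phi = fun p => W 1 p * phi p * cos (dot3 p 0) * expR (- ln (W 1 p))).
  apply: measurable_funM => //; apply: measurableT_comp => //.
  apply: measurableT_comp => //.
  exact: (measurableT_comp (@measurable_ln R) (mW 1 ltr01)).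
apply/funext => p.
by rewrite dot30 cos0 mulr1 expRN lnK ?posrE// mulrAC divff ?mul1r// gt_eqF.
Qed.

(** Dominated convergence: [g] is continuous and bounded by 1, so the Cauchy kernel dominates. *)
Let cvg_gK eta :
  (\int[mu3]_u (g (eta + n.+1%:R^-1 *: u) * cauchy_kernel3 u)%:E @[n --> \oo] -->
   \int[mu3]_u (g eta * cauchy_kernel3 u)%:E)%E.
Proof.
have iK := @integrable_cauchy_kernel3 R.
apply: (@dominated_cvg _ _ _ mu3 setT measurableT
  (fun n u => (g (eta + n.+1%:R^-1 *: u) * cauchy_kernel3 u)%:E)
  _ (fun u => `|cauchy_kernel3 u|%:E)).
- by move=> n; exact: measurable_int (integrable_gK _ _).
- move=> u _; apply: cvg_EFin; first exact: nearW.
  apply: cvgMr_tmp; apply: continuous_cvg; first exact: g_cont.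
  rewrite -[X in _ --> X]addr0 -(scale0r u).
  by apply: cvgD; [exact: cvg_cst|apply: cvgZr_tmp; exact: cvg_harmonic].
- by [].
- exact: integrable_norm iK.
- move=> n u _; rewrite /= lee_fin normrM.
  by rewrite ler_piMl.
Qed.

Let cvg_mollification eta :
  (\int[mu3]_p (W n.+1%:R^-1 p * phi p * cos (dot3 p eta))%:E @[n --> \oo] -->
  (g eta)%:E)%E.
Proof.
have e0 n : 0 < n.+1%:R^-1 :> R by [].
have E n : (\int[mu3]_p (W n.+1%:R^-1 p * phi p * cos (dot3 p eta))%:E =
    ((2 * pi) ^- 3)%:E * \int[mu3]_u (g (eta + n.+1%:R^-1 *: u) * cauchy_kernel3 u)%:E)%E.
  have [iW1 E1] := fourier_mollification _ eta (e0 n).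
  have fW := integrable_fin_num measurableT iW1.
  have fK := integrable_fin_num measurableT (integrable_gK n.+1%:R^-1 eta).
  rewrite -(fineK fW) -(fineK fK).
  by rewrite -EFinM; congr EFin.
under eq_fun do rewrite E.
(* The total mass (2 pi)^3 of the kernel cancels the prefactor. *)
have -> : (g eta)%:E = (((2 * pi) ^- 3)%:E * \int[mu3]_u (g eta * cauchy_kernel3 u)%:E)%E.
  have iK := integrableM_cst mu3 _ integrable_cauchy_kernel3 (g eta).
  rewrite -(fineK (integrable_fin_num measurableT iK)).
  rewrite -[fine _]/(\int[mu3]_u (g eta * cauchy_kernel3 u)).
  rewrite RintegralZl//; last exact: integrable_cauchy_kernel3.
  by rewrite Rintegral_cauchy_kernel3 -EFinM mulrCA mulVf// mulr1.
by apply: cvgeZl => //; exact: cvg_gK.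
Qed.

Let W_mono (p : R3 R) :
  {homo (fun n : nat => W n.+1%:R^-1 p) : n m / (n <= m)%N >-> n <= m}.
Proof.
move=> n m nm; rewrite !WE// ler_expR lerN2 ler_wpM2r ?addr_ge0//.
by rewrite lef_pV2 ?posrE// ler_nat.
Qed.

Let W_cvg p : W n.+1%:R^-1 p @[n --> \oo] --> (1 : R).
Proof.
pose S : R := `|p.1.1| + `|p.1.2| + `|p.2|.
have S0 : - (n.+1%:R^-1 * S) @[n --> \oo] --> - (0 * S).
  by apply: cvgN; apply: cvgMr_tmp; exact: cvg_harmonic.
have := continuous_cvg _ (@continuous_expR R (- (0 * S))) S0.
rewrite mul0r oppr0 expR0.
by rewrite /comp; under eq_fun do rewrite -WE//; apply.
Qed.

(** Since [phi >= 0], monotone convergence evaluates the limit at [eta = 0] before [phi] is known to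
    be integrable; integrability is then a consequence. *)
Lemma integral_inverse_fourier : (\int[mu3]_p (phi p)%:E = (g 0)%:E)%E.
Proof.
have H : (\int[mu3]_p (W n.+1%:R^-1 p * phi p)%:E @[n --> \oo] -->
    \int[mu3]_p (phi p)%:E)%E.
  have := @cvg_monotone_convergence _ _ _ mu3 setT measurableT
    (fun n p => (W n.+1%:R^-1 p * phi p)%:E).
  have -> : (fun p => limn ((fun n p0 => (W n.+1%:R^-1 p0 * phi p0)%:E)^~ p)) =
     fun p => (phi p)%:E.
    apply/funext => p; apply/cvg_lim => //; apply: cvg_EFin; first exact: nearW.
    by rewrite -[X in _ --> X]mul1r; apply: cvgMr_tmp; exact: W_cvg.
  apply.
  - by move=> n; apply/measurable_EFinP; apply: measurable_funM;
      [exact: mW|exact: measurable_inverse_fourier].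
  - by move=> n p _; rewrite lee_fin mulr_ge0// ltW.
  - by move=> p _ n m nm; rewrite lee_fin ler_wpM2r// W_mono.
have := cvg_mollification 0.
under eq_fun do under eq_integral do rewrite dot30 cos0 mulr1.
by move=> /(cvg_unique (@ereal_hausdorff R) H).
Qed.

Lemma integrable_inverse_fourier : mu3.-integrable setT (EFin \o phi).
Proof.
apply/integrableP; split; first
  by apply/measurable_EFinP; exact: measurable_inverse_fourier.
under eq_integral do rewrite gee0_abs ?lee_fin//.
by rewrite integral_inverse_fourier ltry.
Qed.

(** The integrable function [phi] dominates all the damped integrands, whose integrals tend to
    [g eta] by [cvg_mollification]. *)
Lemma fourier_inversion eta : \int[mu3]_p (phi p * cos (dot3 p eta)) = g eta.
Proof.
have ic := integrableM_cos mu3 phi integrable_inverse_fourier _ (measurable_dot3l eta).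
have H : (\int[mu3]_p (W n.+1%:R^-1 p * phi p * cos (dot3 p eta))%:E @[n --> \oo] -->
    \int[mu3]_p (phi p * cos (dot3 p eta))%:E)%E.
  apply: (@dominated_cvg _ _ _ mu3 setT measurableT
    (fun n p => (W n.+1%:R^-1 p * phi p * cos (dot3 p eta))%:E)
    _ (fun p => (phi p)%:E)).
  - move=> n; have [iW1 _] := fourier_mollification n.+1%:R^-1 eta ltac:(by []).
    exact: measurable_int iW1.
  - move=> p _; apply: cvg_EFin; first exact: nearW.
    apply: cvgMr_tmp; rewrite -[X in _ --> X]mul1r; apply: cvgMr_tmp; exact: W_cvg.
  - by [].
  - exact: integrable_inverse_fourier.
  - move=> n p _; rewrite abse_EFin lee_fin -mulrA mulrCA normrM (ger0_norm (phi_ge0 p)).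
    rewrite ler_piMr// normrM mulr_ile1//.
      by rewrite gtr0_norm// WE// -[leRHS]expR0 ler_expR oppr_le0 mulr_ge0// !addr_ge0.
    by rewrite ler_norml cos_geN1 cos_le1.
exact: (congr1 fine (cvg_unique (@ereal_hausdorff R) H (cvg_mollification eta))).
Qed.

End fourier_inversion.

(** * Convolution of inverse Fourier transforms *)

Section convolution.
Context {R : realType}.
Notation mu3 := (lebesgue3 R).
Variables (g1 phi1 g2 phi2 : R3 R -> R).
Hypotheses (pair1 : fourier_pair g1 phi1) (pair2 : fourier_pair g2 phi2).

Let iphi1 := integrable_inverse_fourier _ _ pair1.

Let phi1_even p : phi1 (- p) = phi1 p.
Proof.
rewrite !(fourier_cos _ _ pair1); congr (_ * _).
by apply: eq_Rintegral => eta _; rewrite dot3C dot3N cosN dot3C.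
Qed.

Let phi1_sin eta : \int[mu3]_p (phi1 p * sin (dot3 p eta)) = 0.
Proof.
have is_ := integrableM_sin mu3 phi1 iphi1 _ (measurable_dot3l eta).
have N1 : -1 != 0 :> R by rewrite oppr_eq0 oner_eq0.
have := Rintegral_affine3 0 (-1) _ N1 is_.
rewrite normrN1 expr1n mul1r.
have -> : \int[mu3]_x (phi1 (0 + -1 *: x) * sin (dot3 (0 + -1 *: x) eta)) =
    -1 * \int[mu3]_p (phi1 p * sin (dot3 p eta)).
  rewrite -RintegralZl//; apply: eq_Rintegral => x _.
  by rewrite add0r scaleN1r phi1_even dot3C dot3N sinN dot3C; ring.
by rewrite mulN1r => /eqP; rewrite -addr_eq0 -mulr2n mulrn_eq0/= => /eqP.
Qed.

(** Here [phi2 (p - q)] is replaced by its Fourier integrand. Integrating in frequency first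
    restores the convolution; integrating in [q] first gives [g1 * g2] by inversion for [pair1]. *)
Let f p (z : R3 R * R3 R) : R := phi1 z.1 * g2 z.2 * cos (dot3 z.2 (p - z.1)).

Let fi p : (mu3 \x mu3)%E.-integrable setT (EFin \o f p).
Proof.
apply: (integrableM_cos (mu3 \x mu3)%E (fun z => phi1 z.1 * g2 z.2)
  (integrable_product mu3 mu3 _ _ iphi1 (fourier_integrable _ _ pair2))
  (fun z => dot3 z.2 (p - z.1))).
under eq_fun do rewrite dot3D dot3N dot3C [X in _ - X]dot3C.
apply: measurable_funB; last exact: measurable_dot3.
exact: (measurableT_comp (measurable_dot3r p) measurable_snd).
Qed.

Let fi1 p q : mu3.-integrable setT (fun eta => (f p (q, eta))%:E).
Proof.
rewrite /f/=; under eq_fun do rewrite -mulrA EFinM.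
apply: integrableZl => //.
exact: (integrableM_cos mu3 g2 (fourier_integrable _ _ pair2) _
  (measurable_dot3l (p - q))).
Qed.

Let fi2 p eta : mu3.-integrable setT (fun q => (f p (q, eta))%:E).
Proof.
rewrite /f/=; under eq_fun do rewrite (mulrC (phi1 _)) -mulrA EFinM.
apply: integrableZl => //.
apply: (integrableM_cos mu3 phi1 iphi1 (fun q => dot3 eta (p - q))).
under eq_fun do rewrite dot3D dot3N.
by apply: measurable_funB => //; exact: measurable_dot3r.
Qed.

Let f1 p q : \int[mu3]_eta f p (q, eta) = (2 * pi) ^+ 3 * (phi1 q * phi2 (p - q)).
Proof.
rewrite mulrCA -(fourier_cosE _ _ pair2) -RintegralZl//.
  by apply: eq_Rintegral => eta _; rewrite /f/= dot3C; ring.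
exact: (integrableM_cos mu3 g2 (fourier_integrable _ _ pair2) _
  (measurable_dot3r (p - q))).
Qed.

Let f2 p eta : \int[mu3]_q f p (q, eta) = g1 eta * g2 eta * cos (dot3 p eta).
Proof.
have ic := integrableM_cos mu3 phi1 iphi1 _ (measurable_dot3l eta).
have is_ := integrableM_sin mu3 phi1 iphi1 _ (measurable_dot3l eta).
transitivity (\int[mu3]_q
    (g2 eta * cos (dot3 p eta) * (phi1 q * cos (dot3 q eta)) +
     g2 eta * sin (dot3 p eta) * (phi1 q * sin (dot3 q eta)))).
  apply: eq_Rintegral => q _.
  by rewrite /f/= dot3D dot3N cosB (dot3C eta p) (dot3C eta q); ring.
rewrite RintegralD//; [|exact: (integrableM_cst mu3 _ ic)
  |exact: (integrableM_cst mu3 _ is_)].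
by rewrite !RintegralZl// phi1_sin (fourier_inversion _ _ pair1); ring.
Qed.

(** Valid at every [p]: up to a constant, the integrand is a partial integral of the integrable
    function [f p]. *)
Lemma integrable_convolution p :
  mu3.-integrable setT (fun q => (phi1 q * phi2 (p - q))%:E).
Proof.
have i1 := integrable_Rintegral1 mu3 mu3 _ (fi p) (fi1 p).
rewrite (_ : (fun q => _) = (fun q => ((2 * pi) ^- 3 *
    \int[mu3]_eta f p (q, eta))%:E)).
  exact: (integrableM_cst mu3 (fun q => \int[mu3]_eta f p (q, eta)) i1).
by apply/funext => q; rewrite f1 mulKf// expf_neq0// mulf_neq0// gt_eqF// pi_gt0.
Qed.

Lemma Rintegral_convolution p :
  \int[mu3]_q (phi1 q * phi2 (p - q)) =
  (2 * pi) ^- 3 * \int[mu3]_eta (g1 eta * g2 eta * cos (dot3 p eta)).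
Proof.
have i1 := integrable_Rintegral1 mu3 mu3 _ (fi p) (fi1 p).
have := Rintegral_Fubini mu3 mu3 _ (fi p) (fi1 p) (fi2 p).
under [in X in _ = X -> _]eq_Rintegral do rewrite f2.
move=> <-; rewrite -RintegralZl//; apply: eq_Rintegral => q _.
by rewrite f1 mulKf// expf_neq0// mulf_neq0// gt_eqF// pi_gt0.
Qed.

End convolution.

(** * Homogeneous symbols *)

Lemma lebesgue3_ball_gt0 {R : realType} (x : R3 R) (e : R) : 0 < e ->
  measurable (ball x e) /\ (0 < lebesgue3 R (ball x e))%E.
Proof.
move=> e0.
(* Balls for the product norm are cubes. *)
have -> : ball x e = (ball x.1.1 e `*` ball x.1.2 e) `*` ball x.2 e.
  by apply/seteqP; split=> [[[y1 y2] y3]|[[y1 y2] y3]] [[? ?] ?].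
split.
  by apply: measurableX; [apply: measurableX|]; exact: measurable_ball.
have mb (y : R) : measurable (ball y e) by exact: measurable_ball.
have E2 := product_measure1E (@lebesgue_measure R) (@lebesgue_measure R)
  (mb x.1.1) (mb x.1.2).
have E3 := product_measure1E (lebesgue2 R) (@lebesgue_measure R)
  (measurableX (mb x.1.1) (mb x.1.2)) (mb x.2).
have mu_gt0 (y : R) : (0 < @lebesgue_measure R (ball y e))%E.
  by rewrite lebesgue_measure_ball ?ltW// lte_fin mulrn_wgt0.
rewrite [ltRHS]E3; apply: mule_gt0; last exact: mu_gt0.
by rewrite [ltRHS]E2; apply: mule_gt0; exact: mu_gt0.
Qed.

Section homogeneous_symbol.
Context {R : realType}.
Notation mu3 := (lebesgue3 R).
Variables (theta : R) (b phi : R3 R -> R).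
Hypothesis theta_gt0 : 0 < theta.
Hypothesis b_cont : continuous b.
Hypothesis b_homog : forall (lambda : R) (eta : R3 R), 0 < lambda ->
  b (lambda *: eta) = lambda `^ theta^-1 * b eta.
Hypothesis b_L1 : mu3.-integrable setT (fun eta => (expR (- b eta))%:E).
Hypothesis phi_def : forall p : R3 R,
  (phi p)%:C%C = invFourier (fun eta => (expR (- b eta))%:C%C) p.
Hypothesis phi_ge0 : forall p : R3 R, 0 <= phi p.

Let g eta := expR (- b eta).

(* If [b < 0] on a ball [B], then [exp (- b (c eta)) >= 1] on [B] for every
   [c > 0], whereas its integral is [c^-3] times that of [exp (- b)]. *)
Lemma homogeneous_symbol_ge0 eta : 0 <= b eta.
Proof.
rewrite leNgt; apply/negP => b_lt0.
have /nbhs_ballP[e /= e0 be] : \forall x \near eta, b x < 0.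
  exact: (b_cont eta _ (lt_nbhsl b_lt0)).
have [mB B0] := lebesgue3_ball_gt0 eta e e0.
set B : set (R3 R) := ball eta e in mB B0 be.
have key (c : R) : 0 < c ->
    ((c ^+ 3)%:E * mu3 B <= \int[mu3]_x (g x)%:E)%E.
  move=> c0.
  rewrite (ge0_integral_affine3 0 c)//; last 3 first.
  - exact: lt0r_neq0.
  - exact: measurable_int b_L1.
  - by move=> x; rewrite lee_fin expR_ge0.
  rewrite gtr0_norm// lee_pmul2l ?lte_fin ?exprn_gt0//.
  rewrite -[X in mu3 X]setIT -integral_indic//.
  apply: ge0_le_integral => //.
  - exact/measurable_EFinP.
  - have := integrable_affine3 0 c g (lt0r_neq0 c0) b_L1.
    exact: measurable_int.
  move=> x _; rewrite lee_fin indicE; case: (boolP (x \in B)) => [|_]; last first.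
    exact: expR_ge0.
  rewrite inE => /be bx; rewrite add0r /g b_homog//.
  by rewrite -[leLHS]expR0 ler_expR oppr_ge0 mulr_ge0_le0 ?powR_ge0 ?ltW.
have gfin := integrable_fin_num measurableT b_L1.
pose I := fine (\int[mu3]_x (g x)%:E)%E.
have IE : (\int[mu3]_x (g x)%:E = I%:E)%E by rewrite fineK.
have Bfin : mu3 B \is a fin_num.
  rewrite ge0_fin_numE//; have := key 1 ltr01.
  by rewrite expr1n mul1e IE => /le_lt_trans; apply; rewrite ltry.
pose r := fine (mu3 B).
have r_gt0 : 0 < r by rewrite fine_gt0// B0 ltey_eq Bfin.
have I_ge0 : 0 <= I.
  by apply: fine_ge0; apply: integral_ge0 => x _; rewrite lee_fin expR_ge0.
(* For c = 1 + I / r, which is at least 1, c^3 r >= c r = r + I > I contradicts [key]. *)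
have c_gt0 : 0 < 1 + I / r by rewrite ltr_pwDl// divr_ge0// ltW.
have := key _ c_gt0.
rewrite IE -(fineK Bfin) -/r -EFinM lee_fin leNgt => /negP; apply.
apply: (@lt_le_trans _ _ ((1 + I / r) * r)).
  by rewrite mulrDl divfK ?gt_eqF// mul1r ltrDr.
by rewrite ler_pM2r// ler_eXnr// lerDl divr_ge0// ltW.
Qed.

Definition dilated_symbol (m : R) (eta : R3 R) : R := expR (- (m * b eta)).

Definition dilated_inverse_fourier (m : R) (p : R3 R) : R :=
  m `^ (- (3 * theta)) * phi ((m `^ theta)^-1 *: p).

(** Homogeneity with lambda = m^theta, as (m^theta)^(1/theta) = m. *)
Let dilated_symbolE m eta : 0 < m -> dilated_symbol m eta = g (m `^ theta *: eta).
Proof.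
move=> m0; rewrite /dilated_symbol /g b_homog ?powR_gt0//.
by rewrite -powRrM mulfV ?gt_eqF// powRr1// ltW.
Qed.

(** Real and imaginary parts of [phi_def]; the second vanishes because [phi] is real-valued. *)
Let phi_fourier p :
  phi p = (2 * pi) ^- 3 * \int[mu3]_eta (g eta * cos (dot3 p eta)) /\
  \int[mu3]_eta (g eta * sin (dot3 p eta)) = 0.
Proof.
have := phi_def p; rewrite /invFourier.
under [X in (_ * (X +i* _))%C]eq_Rintegral do rewrite /= mul0r subr0.
under [X in (_ * (_ +i* X))%C]eq_Rintegral do rewrite /= mul0r addr0.
rewrite -/(g _) => /=; set A := (X in (_ * (X +i* _))%C).
set B := (X in (_ * (_ +i* X))%C).
have k0 : (2 * pi) ^- 3 != 0 :> R.
  by rewrite invr_neq0// expf_neq0// mulf_neq0// gt_eqF// pi_gt0.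
case=> -> /esym/eqP; rewrite !mul0r subr0 addr0 mulf_eq0 (negbTE k0) => /eqP B0.
by [].
Qed.

(** Everything is carried over from [g] and [phi] by the dilation of ratio c = m^theta, whose
    Jacobian c^3 cancels the factor m^(-3 theta). The bound by 1 is the nonnegativity of [b]. *)
Lemma dilated_fourier_pair m : 0 < m ->
  fourier_pair (dilated_symbol m) (dilated_inverse_fourier m).
Proof.
move=> m0.
have c0 : 0 < m `^ theta by rewrite powR_gt0.
set c := m `^ theta in c0.
have cN0 := lt0r_neq0 c0.
have dilE : dilated_symbol m = (fun eta => g (0 + c *: eta)).
  by apply/funext => eta; rewrite add0r dilated_symbolE.
have c3 : m `^ (- (3 * theta)) = c ^- 3.
  by rewrite powRN mulrC powRrM powR_mulrn ?powR_ge0.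
have dotc p eta : dot3 p eta = dot3 (c^-1 *: p) (0 + c *: eta).
  by rewrite add0r dot3Zr dot3Zl mulrA mulfV// mul1r.
split.
- by rewrite dilE; exact: (integrable_affine3 0 c g cN0 b_L1).
- move=> eta; rewrite /dilated_symbol.
  apply: (@continuous_comp _ _ _ (fun x => - (m * b x)) expR);
    last exact: continuous_expR.
  by apply: cvgN; apply: cvgMl_tmp; exact: b_cont.
- move=> eta; rewrite ger0_norm ?expR_ge0// -expR0 ler_expR oppr_le0.
  by rewrite mulr_ge0 ?homogeneous_symbol_ge0// ltW.
- move=> p; rewrite /dilated_inverse_fourier -/c c3.
  have [-> _] := phi_fourier (c^-1 *: p).
  have ic := integrableM_cos mu3 g b_L1 _ (measurable_dot3r (c^-1 *: p)).
  rewrite (Rintegral_affine3 0 c _ cN0 ic) gtr0_norm// dilE.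
  rewrite mulrCA mulKf ?expf_neq0//; congr (_ * _).
  by apply: eq_Rintegral => eta _; rewrite -dotc.
- move=> p; have [_] := phi_fourier (c^-1 *: p).
  have is_ := integrableM_sin mu3 g b_L1 _ (measurable_dot3r (c^-1 *: p)).
  rewrite (Rintegral_affine3 0 c _ cN0 is_) gtr0_norm// dilE => /eqP.
  rewrite mulf_eq0 expf_eq0 (negbTE cN0)/= => /eqP <-.
  by apply: eq_Rintegral => eta _; rewrite -dotc.
- by move=> p; rewrite mulr_ge0// powR_ge0.
Qed.

Lemma dilated_symbolM m m' eta :
  dilated_symbol m eta * dilated_symbol m' eta = dilated_symbol (m + m') eta.
Proof. by rewrite /dilated_symbol -expRD mulrDl opprD. Qed.

Lemma dilated_symbol0 m : dilated_symbol m 0 = 1.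
Proof.
have b0 : b 0 = 0.
  (* For lambda = 2^theta, homogeneity at the origin reads b(0) = 2 b(0). *)
  have lambda_gt0 : 0 < (2 : R) `^ theta by rewrite powR_gt0.
  have := b_homog _ 0 lambda_gt0.
  by rewrite scaler0 -powRrM mulfV ?gt_eqF// powRr1//; lra.
by rewrite /dilated_symbol b0 mulr0 oppr0 expR0.
Qed.

End homogeneous_symbol.

(** * Ballistic aggregation *)

Section constant_fibre.
Context {d1 d2 : measure_display} {T1 : measurableType d1}
  {T2 : measurableType d2} {R : realType}.
Variables (m1 : {sigma_finite_measure set T1 -> \bar R})
  (m2 : {sigma_finite_measure set T2 -> \bar R}).
Variables (D : set T2) (k : T2 -> R) (h : T1 * T2 -> R) (c : R).
Hypotheses (mD : measurable D) (mh : measurable_fun setT h).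
Hypothesis ik : m2.-integrable D (EFin \o k).
Hypothesis k_ge0 : forall y, D y -> 0 <= k y.
Hypothesis h_ge0 : forall x y, D y -> 0 <= h (x, y).
Hypothesis hE : forall y, D y -> (\int[m1]_x (h (x, y))%:E = c%:E)%E.

(** Extending [k] by zero outside [D] turns the integral over the strip into one over the whole
    product, where Tonelli applies. *)
Let f z := (k \_ D) z.2 * h z.

Let fE : (fun z => (k z.2 * h z)%:E) \_ (setT `*` D) = EFin \o f.
Proof.
apply/funext => -[x y]; rewrite /f /patch /= in_setX in_setT/=.
by case: ifP => // _; rewrite mul0r.
Qed.

Let f_ge0 z : 0 <= f z.
Proof.
case: z => x y; rewrite /f /patch/=; case: ifPn => [|_]; last by rewrite mul0r.
by rewrite inE => Dy; rewrite mulr_ge0 ?k_ge0 ?h_ge0.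
Qed.

Let mf : measurable_fun setT f.
Proof.
have mk : measurable_fun setT (k \_ D).
  apply/(measurable_restrictT _ mD).1/measurable_EFinP.
  exact: measurable_int ik.
by apply: measurable_funM => //; exact: (measurableT_comp mk measurable_snd).
Qed.

Let integral_f : (\int[(m1 \x m2)%E]_z (f z)%:E =
  (\int[m2]_(y in D) (k y)%:E) * c%:E)%E.
Proof.
rewrite fubini_tonelli2//; last exact/measurable_EFinP.
rewrite -integralZr// integral_mkcond; apply: eq_integral => y _.
rewrite /fubini_G /f /patch/=; case: ifPn => [|_]; last first.
  by under eq_integral do rewrite mul0r; rewrite integral0.
rewrite inE => Dy; under eq_integral do rewrite EFinM.
rewrite ge0_integralZl_EFin ?hE ?k_ge0//.
- by move=> x _; rewrite lee_fin h_ge0.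
- exact/measurable_EFinP/(measurableT_comp mh (pair2_measurable y)).
Qed.

Lemma integrable_constant_fibre :
  (m1 \x m2)%E.-integrable (setT `*` D) (fun z => (k z.2 * h z)%:E).
Proof.
apply/integrable_mkcond; first exact: measurableX.
rewrite fE; apply/integrableP; split; first exact/measurable_EFinP.
under eq_integral do rewrite gee0_abs ?lee_fin//.
rewrite integral_f -(fineK (integrable_fin_num mD ik)) -EFinM; exact: ltry.
Qed.

Lemma Rintegral_constant_fibre :
  \int[(m1 \x m2)%E]_(z in setT `*` D) (k z.2 * h z) =
  (\int[m2]_(y in D) k y) * c.
Proof.
rewrite /Rintegral integral_mkcond fE integral_f.
by rewrite fineM//; exact: integrable_fin_num ik.
Qed.

End constant_fibre.

(** * The convolution semigroup of dilated densities *)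

Section dilated_inverse_fourier.
Context {R : realType}.
Notation mu3 := (lebesgue3 R).
Variables (theta : R) (b phi : R3 R -> R).
Hypothesis dilated_pair : forall m : R, 0 < m ->
  fourier_pair (dilated_symbol b m) (dilated_inverse_fourier theta phi m).
Hypothesis dilated1 : forall m : R, dilated_symbol b m 0 = 1.

Let phi_ m := dilated_inverse_fourier theta phi m.

Lemma integral_dilated (m : R) : 0 < m ->
  (\int[mu3]_p (phi_ m p)%:E = 1%:E)%E.
Proof.
move=> m0.
by rewrite (integral_inverse_fourier _ _ (dilated_pair m m0)) dilated1.
Qed.

(** The semigroup law: the symbols of masses [m] and [m'] multiply to the symbol of [m + m']. *)
Lemma integral_dilated_convolution (m m' : R) p : 0 < m -> 0 < m' ->
  (\int[mu3]_q (phi_ m q * phi_ m' (p - q))%:E = (phi_ (m + m') p)%:E)%E.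
Proof.
move=> m0 m'0.
have ic := integrable_convolution _ _ _ _ (dilated_pair m m0) (dilated_pair m' m'0) p.
rewrite -(fineK (integrable_fin_num measurableT ic)); congr EFin.
rewrite [LHS](Rintegral_convolution _ _ _ _ (dilated_pair m m0) (dilated_pair m' m'0) p).
rewrite [RHS](fourier_cos _ _ (dilated_pair _ (addr_gt0 m0 m'0))).
by congr (_ * _); apply: eq_Rintegral => eta _; rewrite dilated_symbolM.
Qed.

Lemma measurable_dilated :
  measurable_fun setT (fun z : R3 R * R => phi_ z.2 z.1).
Proof.
have mphi : measurable_fun setT phi.
  (* The density of mass 1 is [phi] itself. *)
  have := measurable_inverse_fourier _ _ (dilated_pair 1 ltr01).
  rewrite /dilated_inverse_fourier powR1 invr1.
  by under eq_fun do rewrite mul1r scale1r.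
have mpow r : measurable_fun setT (fun z : R3 R * R => z.2 `^ r).
  exact: (measurableT_comp (measurable_powR r) measurable_snd).
apply: measurable_funM; first exact: mpow.
apply: (measurableT_comp mphi).
have -> : (fun z : R3 R * R => (z.2 `^ theta)^-1 *: z.1) =
   (fun z => (z.2 `^ (- theta) * z.1.1.1, z.2 `^ (- theta) * z.1.1.2,
      z.2 `^ (- theta) * z.1.2)).
  by apply/funext => -[[[x1 x2] x3] m]; rewrite powRN.
have m1 : measurable_fun setT (fun z : R3 R * R => z.1.1.1).
  exact: (measurableT_comp measurable_fst
    (measurableT_comp measurable_fst measurable_fst)).
have m2 : measurable_fun setT (fun z : R3 R * R => z.1.1.2).
  exact: (measurableT_comp measurable_snd
    (measurableT_comp measurable_fst measurable_fst)).
have m3 : measurable_fun setT (fun z : R3 R * R => z.1.2).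
  exact: (measurableT_comp measurable_snd measurable_fst).
apply/measurable_fun_pairP; split; [apply/measurable_fun_pairP; split|].
- exact: (measurable_funM (mpow (- theta)) m1).
- exact: (measurable_funM (mpow (- theta)) m2).
- exact: (measurable_funM (mpow (- theta)) m3).
Qed.

End dilated_inverse_fourier.

Theorem theorem1 (R : realType)
  (a : R -> R -> R)
  (a_ge0 : forall m m' : R, 0 < m -> 0 < m' -> 0 <= a m m')
  (a_sym : forall m m' : R, 0 < m -> 0 < m' -> a m m' = a m' m)
  (theta : R) (theta_gt0 : 0 < theta)
  (b : R3 R -> R)
  (b_smooth : smooth b)
  (b_homog : forall (lambda : R) (eta : R3 R), 0 < lambda ->
     b (lambda *: eta) = lambda `^ theta^-1 * b eta)
  (b_L1 : (lebesgue3 R).-integrable setT (fun eta => (expR (- b eta))%:E))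
  (phi : R3 R -> R)
  (phi_def : forall p : R3 R,
     (phi p)%:C%C = invFourier (fun eta => (expR (- b eta))%:C%C) p)
  (phi_ge0 : forall p : R3 R, 0 <= phi p)
  (J : set R) (J_open : open J)
  (F : R -> R -> R)
  (F_sol : smoluchowski_solution a J F) :
  ballistic_solution a J
    (fun t m p => m `^ (- (3 * theta)) * F t m * phi ((m `^ theta)^-1 *: p)).
Proof.
have b_cont : continuous b := b_smooth 0%N.
have dpair (m : R) (m_gt0 : 0 < m) :=
  dilated_fourier_pair theta b phi theta_gt0 b_cont b_homog b_L1 phi_def phi_ge0
    m m_gt0.
have d1 := dilated_symbol0 theta b theta_gt0 b_homog.
pose phi_ m := dilated_inverse_fourier theta phi m.
have mphi := measurable_dilated theta b phi dpair.
have phi_ge m p : 0 < m -> 0 <= phi_ m p.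
  by move=> m0; exact: inverse_fourier_ge0 (dpair m m0) p.
move=> t m p Jt m0.
have F_ge0 m' : 0 < m' -> 0 <= F t m'.
  by move=> m'0; have [] := F_sol t m' Jt m'0.
have [_ igain iloss dF] := F_sol t m Jt m0.
move=> gain loss.
(* Each ballistic integrand splits into the Smoluchowski integrand, in the mass alone, and a product
   of densities whose momentum integral is [phi_ m p] in both cases. *)
pose kgain m' := F t (m - m') * F t m' * a (m - m') m'.
pose hgain (z : R3 R * R) := phi_ z.2 z.1 * phi_ (m - z.2) (p - z.1).
pose kloss m' := F t m * F t m' * a m m'.
pose hloss (z : R3 R * R) := phi_ m p * phi_ z.2 z.1.
have in0m m' : `]0, m[%classic m' -> 0 < m' /\ 0 < m - m'.
  by rewrite /= in_itv/= subr_gt0 => /andP.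
have in0y m' : `]0, +oo[%classic m' -> 0 < m'.
  by rewrite /= in_itv/= andbT.
have mhgain : measurable_fun setT hgain.
  apply: measurable_funM; first exact: mphi.
  have mreflect : measurable_fun setT (fun z : R3 R * R => (p - z.1, m - z.2)).
    apply/measurable_fun_pairP; split.
      rewrite (_ : _ \o _ = (fun q : R3 R => p + -1 *: q) \o fst).
        exact: (measurableT_comp (measurable_affine3 p (-1)) measurable_fst).
      by apply/funext => z; rewrite /= scaleN1r.
    exact: (measurable_funB (measurable_cst m) measurable_snd).
  exact: (measurableT_comp mphi mreflect).
have mhloss : measurable_fun setT hloss by exact: measurable_funM.
(* The two equations list the arguments of [a] in opposite orders; symmetry is available at positive
   masses, hence the restriction to the strip. *)
have gainE z : (setT `*` `]0, m[%classic) z -> gain z = kgain z.2 * hgain z.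
  move=> [_ /in0m[z0 mz0]].
  by rewrite /gain /kgain /hgain /phi_ /dilated_inverse_fourier (a_sym z.2)//; ring.
have lossE z : loss z = kloss z.2 * hloss z.
  by rewrite /loss /kloss /hloss /phi_ /dilated_inverse_fourier; ring.
have kgain_ge0 m' : `]0, m[%classic m' -> 0 <= kgain m'.
  by move=> /in0m[z0 mz0]; rewrite !mulr_ge0 ?F_ge0 ?a_ge0.
have kloss_ge0 m' : `]0, +oo[%classic m' -> 0 <= kloss m'.
  by move=> /in0y z0; rewrite !mulr_ge0 ?F_ge0 ?a_ge0.
have hgain_ge0 q m' : `]0, m[%classic m' -> 0 <= hgain (q, m').
  by move=> /in0m[z0 mz0]; rewrite mulr_ge0 ?phi_ge.
have hloss_ge0 q m' : `]0, +oo[%classic m' -> 0 <= hloss (q, m').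
  by move=> /in0y z0; rewrite mulr_ge0 ?phi_ge.
(* The masses [m'] and [m - m'] add up to [m], so the value is the same on every fibre. *)
have hgain_int m' : `]0, m[%classic m' ->
    (\int[lebesgue3 R]_q (hgain (q, m'))%:E = (phi_ m p)%:E)%E.
  move=> /in0m[z0 mz0].
  by rewrite (integral_dilated_convolution theta b phi dpair _ _ p z0 mz0) subrKC.
have hloss_int m' : `]0, +oo[%classic m' ->
    (\int[lebesgue3 R]_q (hloss (q, m'))%:E = (phi_ m p)%:E)%E.
  move=> /in0y z0.
  under eq_integral do rewrite EFinM.
  rewrite ge0_integralZl_EFin ?phi_ge//.
  - by rewrite (integral_dilated theta b phi dpair d1 _ z0) mule1.
  - by move=> q _; rewrite lee_fin phi_ge.
  - apply/measurable_EFinP.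
    exact: (measurable_inverse_fourier _ _ (dpair m' z0)).
have mgainD : measurable (`]0, m[%classic : set R) by exact: measurable_itv.
have mlossD : measurable (`]0, +oo[%classic : set R) by exact: measurable_itv.
have Igain := integrable_constant_fibre (lebesgue3 R) (@lebesgue_measure R)
  _ kgain hgain _ mgainD mhgain igain kgain_ge0 hgain_ge0 hgain_int.
have Rgain := Rintegral_constant_fibre (lebesgue3 R) (@lebesgue_measure R)
  _ kgain hgain _ mgainD mhgain igain kgain_ge0 hgain_ge0 hgain_int.
have Iloss := integrable_constant_fibre (lebesgue3 R) (@lebesgue_measure R)
  _ kloss hloss _ mlossD mhloss iloss kloss_ge0 hloss_ge0 hloss_int.
have Rloss := Rintegral_constant_fibre (lebesgue3 R) (@lebesgue_measure R)
  _ kloss hloss _ mlossD mhloss iloss kloss_ge0 hloss_ge0 hloss_int.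
split.
- by rewrite !mulr_ge0 ?powR_ge0 ?F_ge0.
- apply: eq_integrable Igain; first by apply: measurableX.
  by move=> z; rewrite inE => zD; rewrite /= gainE.
- apply: eq_integrable Iloss; first by apply: measurableX.
  by move=> z _; rewrite /= lossE.
- have -> : \int[lebesgue3_1 R]_(z in setT `*` `]0, m[) gain z =
      (\int[lebesgue_measure]_(m' in `]0, m[) kgain m') * phi_ m p.
    rewrite -Rgain; apply: eq_Rintegral => z; rewrite inE => zD.
    exact: gainE.
  have -> : \int[lebesgue3_1 R]_(z in setT `*` `]0, +oo[) loss z =
      (\int[lebesgue_measure]_(m' in `]0, +oo[) kloss m') * phi_ m p.
    by rewrite -Rloss; apply: eq_Rintegral => z _; exact: lossE.
  (* At fixed [m] and [p] the candidate is a constant multiple of [F ^~ m], and the right-hand side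
     carries the same factor [phi_ m p]. *)
  rewrite (_ : (fun s => _) = phi_ m p \*: F ^~ m); last first.
    apply/funext => s /=; rewrite /phi_ /dilated_inverse_fourier.
    by rewrite -[RHS]/(_ * _); ring.
  rewrite (_ : _ - _ = phi_ m p *: (2^-1 *
       (\int[lebesgue_measure]_(m' in `]0, m[) kgain m')
     - \int[lebesgue_measure]_(m' in `]0, +oo[) kloss m')); last first.
    by rewrite -[RHS]/(_ * _); ring.
  exact: is_deriveZ.
Qed.
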